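(* Let $(x_1,x_2)$ be a pair of consecutive solutions in $S$, and let $\delta\in\mathbb{R}^+$ be such that $\mu_\delta(x_1)=\mu_\delta(x_2)$. Let $\overline{V}_1(x_1,\delta)=\mu_\delta(x_1)-\delta\beta$. Then $\overline{V}_1(x_1,\delta)$ is an upper bound on the value $V_1(x^* )$ of the optimal solution $x^*$ of $(P)$.
   Context: Problem $(P)$: maximize $cx$ subject to $x\in X$, $\beta\le\gamma x\le\alpha$ (main additional constraint), and $\widetilde\beta_k\le\widetilde\gamma^k x\le\widetilde\alpha_k$ for $k\in\{1,\dots,K\}$, where $X\subset\mathbb{R}^n$ is nonempty, $\alpha,\beta,\widetilde\alpha_k,\widetilde\beta_k\in\mathbb{R}$, and $c,\gamma,\widetilde\gamma^k\in\mathbb{R}^n$. Standing assumptions: the convex hull of $X$ is a polytope (bounded, finitely many extreme points), and there is an optimal solution $x^*_{SP}$ of $\max_{x\in X}cx$ with $\gamma x^*_{SP}\le\beta$. The bi-objective relaxation $(BOR)$ maximizes the vector $(V_1(x),V_2(x))=(cx,\gamma x)$ over $x\in X$; its solutions are the elements of $X$. For $\delta\in\mathbb{R}^+$ (nonnegative reals), $\mu_\delta(x)=V_1(x)+\delta V_2(x)$, and by convention $\mu_{+\infty}(x)=V_2(x)$. A solution $x$ strongly Pareto-dominates $x'$ if $V_1(x)\ge V_1(x')$ and $V_2(x)\ge V_2(x')$ with at least one strict inequality; $x$ is Pareto-optimal if no solution strongly dominates it. A solution $x$ is Pareto-supported if it is Pareto-optimal, $(V_1(x),V_2(x))$ is an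 extreme point of the convex hull of $\{(V_1(y),V_2(y)): y\in X\}$, and $x$ maximizes $\mu_\delta$ over $X$ for some $\delta\in\mathbb{R}^+\cup\{+\infty\}$. $S$ is the set of Pareto-supported solutions, with one representative kept for each pair of values $(V_1,V_2)$, ordered by increasing $V_1$; ''consecutive'' refers to this order, $x_1$ preceding $x_2$. *)

(* Defs.v *)
From mathcomp Require Import all_boot all_order all_algebra.
From mathcomp Require Import interval_inference.
From mathcomp Require Import boolp classical_sets cardinality reals ereal convex.

Set Implicit Arguments.
Unset Strict Implicit.
Unset Printing Implicit Defensive.

Import Order.TTheory GRing.Theory Num.Theory.
Local Open Scope classical_set_scope.
Local Open Scope ring_scope.
Local Open Scope convex_scope.

Section ConvexGeometry.
Context {R : realType} {E : lmodType R}.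
Implicit Types (A : set (convex_lmodType E)) (x : convex_lmodType E).

Definition convex_hull A : set (convex_lmodType E) :=
  smallest (@convex_set R E) A.

Definition extreme_point A x : Prop :=
  A x /\ forall y z (t : {i01 R}), A y -> A z ->
    0 < t%:num < 1 -> x = y <| t |> z -> y = x /\ z = x.

(* A mere "bounded with finitely many extreme points" would not make the set
   closed (e.g. an open ball), so the usual definition of polytopes is used. *)
Definition polytope A : Prop :=
  exists2 F : set (convex_lmodType E), finite_set F & A = convex_hull F.

End ConvexGeometry.

Definition maximizes {R : realType} {T : Type} (f : T -> R) (A : set T)
    (x : T) : Prop :=
  A x /\ forall y, A y -> f y <= f x.

Definition dotp {R : realType} {n : nat} (a : 'rV[R]_n) (x : 'cV[R]_n) : R :=
  (a *m x) 0 0.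

Definition feasible {R : realType} {n K : nat} (X : set 'cV[R]_n)
    (gamma : 'rV[R]_n) (alpha beta : R)
    (tgamma : 'I_K -> 'rV[R]_n) (talpha tbeta : 'I_K -> R) : set 'cV[R]_n :=
  [set x | [/\ X x, beta <= dotp gamma x <= alpha
    & forall k, tbeta k <= dotp (tgamma k) x <= talpha k]].

Section BiObjective.
Context {R : realType} {T : Type}.
Variables (V1 V2 : T -> R) (X : set T).
Implicit Types (x y : T) (delta : \bar R).

Definition outcome x : convex_lmodType (R^o * R^o)%type := (V1 x, V2 x).

(* Only meant for 0 <= delta; the value at -oo is irrelevant. *)
Definition mu delta x : R :=
  if delta is d%:E then V1 x + d * V2 x else V2 x.

Definition strongly_dominates x y : Prop :=
  V1 y <= V1 x /\ V2 y <= V2 x /\ (V1 y < V1 x \/ V2 y < V2 x).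

Definition pareto_optimal x : Prop :=
  X x /\ ~ exists2 y, X y & strongly_dominates y x.

Definition pareto_supported x : Prop :=
  [/\ pareto_optimal x,
      extreme_point (convex_hull (outcome @` X)) (outcome x)
    & exists2 delta, (0 <= delta)%E & maximizes (mu delta) X x].

(* The set S is determined only up to the choice of the representatives. *)
Definition supported_representatives (S : set T) : Prop :=
  S `<=` pareto_supported /\
  forall x, pareto_supported x -> exists! s, S s /\ outcome s = outcome x.

(* Distinct elements of S have distinct values of V1. *)
Definition consecutive (S : set T) x y : Prop :=
  [/\ S x, S y, V1 x < V1 y & ~ exists2 z, S z & V1 x < V1 z < V1 y].

Definition V1bar (beta : R) x (d : R) : R := mu d%:E x - d * beta.

End BiObjective.

(* Main.v *)
Require Import Defs.
From mathcomp Require Import all_boot all_order all_algebra.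
From mathcomp Require Import interval_inference.
From mathcomp Require Import boolp classical_sets cardinality reals ereal convex.
From mathcomp Require Import ring lra.

Set Implicit Arguments.
Unset Strict Implicit.
Unset Printing Implicit Defensive.

Import Order.TTheory GRing.Theory Num.Theory.
Local Open Scope classical_set_scope.
Local Open Scope ring_scope.

(** The bound follows once [x1] is known to maximize [mu delta] over all of [X]:
    any [x] in [X] with [beta <= V2 x], in particular a feasible one, then has
    [V1 x + delta * beta <= mu delta x <= mu delta x1].

    So the heart of the matter is that a line through two consecutive supported
    points of the outcome space supports the whole outcome set
    ([consecutive_mu_max]). Since [x1] and [x2] are Pareto-optimal with distinct
    values of [V1] and the same value of [mu delta], necessarily [0 < delta]. The
    convex hull of the outcomes is a polytope, being the affine image of one
    ([polytope_hull_image]), so [mu delta] has a maximum on it; breaking ties by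
    the largest [V1] gives a maximizer that is an extreme point
    ([polytope_lex_max], [lex_max_extreme]). An extreme point of a convex hull
    belongs to the generating set ([extreme_point_hull_mem]), so this maximizer
    is the outcome of a Pareto-supported solution, represented by some [s] in
    [S]. By consecutiveness, [V1 s] is not strictly between [V1 x1] and [V1 x2].
    If [s] were strictly above the line through the outcomes of [x1] and [x2],
    then either it would dominate one of them, or the one of [x1] and [x2] that
    is nearer to [s] would lie strictly below the chord joining the other one
    to [s]; but a supported outcome is never below a chord
    ([supported_concave]). *)

(** * Convex hulls, affine maps and polytopes *)

Section ConvexHull.
Context {R : realType}.
Local Open Scope convex_scope.

Lemma conv_lmodE {E : lmodType R} (t : {i01 R}) (x y : convex_lmodType E) :
  x <| t |> y = t%:num *: (x : E) + (1 - t%:num) *: (y : E).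
Proof. by []. Qed.

Lemma convex_setP {E : lmodType R} (A : set (convex_lmodType E)) :
  convex_set A <-> forall x y t, A x -> A y -> A (x <| t |> y).
Proof.
split=> cA x y t; last by rewrite !inE; exact: cA.
by move=> Ax Ay; have := cA x y t; rewrite !inE; apply.
Qed.

Lemma convex_hull_convex {E : lmodType R} (A : set (convex_lmodType E)) :
  convex_set (convex_hull A).
Proof.
apply/convex_setP => x y t Ax Ay B [cB AB].
by move/convex_setP: (cB); apply; [exact: Ax|exact: Ay].
Qed.

(** If [x] were not in [A], then the hull with the extreme point [x] removed
    would still be convex and contain [A], contradicting minimality. *)
Lemma extreme_point_hull_mem {E : lmodType R} (A : set (convex_lmodType E)) x :
  extreme_point (convex_hull A) x -> A x.
Proof.
move=> [Ax ext]; apply: contrapT => nAx.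
suff /(_ _ Ax)[_] : convex_hull A `<=` convex_hull A `\ x by apply.
apply: smallest_sub; last first.
  move=> a Aa; split; first exact: sub_gen_smallest.
  by move=> /= ax; apply: nAx; rewrite -ax.
apply/convex_setP => y z t [Ay yx] [Az zx]; split.
  by move/convex_setP: (@convex_hull_convex E A); apply.
move=> /= /esym xE.
(* Extremality only concerns 0 < t < 1; at both ends x would be y or z. *)
have [t0|t0] := eqVneq t 0%:i01.
  by apply: zx => /=; rewrite xE t0 conv0.
have [t1|t1] := eqVneq t 1%:i01.
  by apply: yx => /=; rewrite xE t1 conv1.
apply: yx; apply: (ext y z t Ay Az _ xE).1.
apply/andP; split.
- by rewrite lt_neqAle eq_sym t0 ge0.
- by rewrite lt_neqAle t1 le1.
Qed.

(** These maps are the morphisms of convex spaces; between modules they are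
    exactly the linear maps up to a translation. *)
Definition affine {E F : lmodType R}
    (f : convex_lmodType E -> convex_lmodType F) : Prop :=
  forall t x y, f (x <| t |> y) = f x <| t |> f y.

Lemma convex_set_preimage {E F : lmodType R}
    (f : convex_lmodType E -> convex_lmodType F) (B : set (convex_lmodType F)) :
  affine f -> convex_set B -> convex_set (f @^-1` B).
Proof.
move=> af /convex_setP cB; apply/convex_setP => x y t /= Bx By.
by rewrite af; exact: cB.
Qed.

Lemma convex_hull_image {E F : lmodType R}
    (f : convex_lmodType E -> convex_lmodType F) (A B : set (convex_lmodType E)) :
  affine f -> A `<=` convex_hull B ->
  convex_hull (f @` A) `<=` convex_hull (f @` B).
Proof.
move=> af AB; apply: smallest_sub; first exact: convex_hull_convex.
move=> _ [a /AB Ba <-]; move: a Ba.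
apply: smallest_sub.
  by apply: convex_set_preimage => //; exact: convex_hull_convex.
by move=> b Bb; apply: sub_gen_smallest; exists b.
Qed.

(** The images of the finitely many generators of the hull of [A] generate the
    hull of the image, although these generators need not belong to [A]. *)
Lemma polytope_hull_image {E F : lmodType R}
    (f : convex_lmodType E -> convex_lmodType F) (A : set (convex_lmodType E)) :
  affine f -> polytope (convex_hull A) -> polytope (convex_hull (f @` A)).
Proof.
move=> af [G finG AG]; exists (f @` G); first exact: finite_image.
apply/seteqP; split; apply: convex_hull_image => // x; last rewrite AG.
- by move=> Ax; rewrite -AG; exact: sub_gen_smallest.
- exact: sub_gen_smallest.
Qed.

End ConvexHull.

(** * Lexicographic maxima over polytopes *)

Section LexicographicMaximum.
Context {R : realType} {E : lmodType R}.
Local Open Scope convex_scope.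
Variables u w : convex_lmodType E -> convex_lmodType R^o.
Hypotheses (u_affine : affine u) (w_affine : affine w).

Definition lex_le (x y : convex_lmodType E) : Prop :=
  (u x : R) < u y \/ (u x = u y /\ (w x : R) <= w y).

Lemma lex_le_trans y x z : lex_le x y -> lex_le y z -> lex_le x z.
Proof. rewrite /lex_le; lra. Qed.

Lemma lex_le_total x y : lex_le x y \/ lex_le y x.
Proof. rewrite /lex_le; lra. Qed.

(** This is why lexicographic upper bounds pass from the generators of a
    polytope to the whole of it. A strict inequality in [u] at either end of a proper
    combination makes it strict in between; otherwise [u] is constant and
    the bound on [w] is averaged. *)
Lemma convex_lex_le y : convex_set [set x | lex_le x y].
Proof.
apply/convex_setP => a b t /=; rewrite /lex_le u_affine w_affine !conv_lmodE.
have /andP[] : 0 <= t%:num <= 1 by rewrite ge0 le1.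
rewrite /GRing.scale /=; move: t%:num => s s0 s1.
move: (u a : R) (u b : R) (u y : R) (w a : R) (w b : R) (w y : R).
move=> ua ub uy wa wb wy ale ble.
have [->|s_neq0] := eqVneq s 0; first by rewrite !mul0r !add0r subr0 !mul1r.
have [->|s_neq1] := eqVneq s 1; first by rewrite !mul1r subrr !mul0r !addr0.
have {s_neq0}s0 : 0 < s by rewrite lt_neqAle eq_sym s_neq0.
have {s_neq1}s1 : 0 < 1 - s by rewrite subr_gt0 lt_neqAle s_neq1.
case: ale ble => [au|[-> aw]] [bu|[-> bw]]; [left; nra..|right].
by split; [ring|nra].
Qed.

Lemma seq_lex_max (s : seq (convex_lmodType E)) x0 : x0 \in s ->
  exists2 e, e \in s & forall x, x \in s -> lex_le x e.
Proof.
elim: s x0 => // a [|b s] IH x0 _.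
  exists a; first exact: mem_head.
  by move=> x; rewrite inE => /eqP ->; right.
have [e es emax] := IH b (mem_head _ _).
have [ae|ea] := lex_le_total a e.
  exists e; first by rewrite inE es orbT.
  by move=> x; rewrite inE => /predU1P[->//|]; exact: emax.
exists a; first exact: mem_head.
move=> x; rewrite inE => /predU1P[->|/emax xe]; first by right.
exact: lex_le_trans xe ea.
Qed.

Lemma polytope_lex_max (P : set (convex_lmodType E)) : polytope P -> P !=set0 ->
  exists2 e, P e & forall x, P x -> lex_le x e.
Proof.
move=> [F /finite_seqP[s FE] PE] [p Pp].
have hullP e : (forall x, F x -> lex_le x e) -> forall x, P x -> lex_le x e.
  by move=> emax; rewrite PE; apply: smallest_sub => //; exact: convex_lex_le.
case: s FE => [|a s] FE.
  suff P0 : P `<=` set0 by case: (P0 p Pp).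
  rewrite PE FE; apply: smallest_sub; last by move=> x.
  by apply/convex_setP.
have [e es emax] := seq_lex_max (mem_head a s).
exists e; last by apply: hullP => x; rewrite FE; exact: emax.
by rewrite PE FE; exact: sub_gen_smallest.
Qed.

(** A proper convex combination of values at most [u e] that equals [u e] has
    both values equal to [u e], and then the same applies to [w]. *)
Lemma lex_max_extreme (P : set (convex_lmodType E)) e :
  (forall x y, u x = u y -> w x = w y -> x = y) ->
  P e -> (forall x, P x -> lex_le x e) -> extreme_point P e.
Proof.
move=> uw_inj Pe emax; split=> // y z t /emax ye /emax ze.
move=> + eE; move: (congr1 u eE) (congr1 w eE) ye ze.
rewrite u_affine w_affine !conv_lmodE /lex_le /GRing.scale /=.
move: t%:num => s ue we ye ze /andP[s0 s1].
have [uy uz] : (u y : R) = u e /\ (u z : R) = u e by split; nra.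
have [wy wz] : (w y : R) = w e /\ (w z : R) = w e by split; nra.
by split; exact: uw_inj.
Qed.

End LexicographicMaximum.

(** * Supported points of the outcome space *)

Lemma outcome_affine {R : realType} {E : lmodType R}
    (V1 V2 : convex_lmodType E -> convex_lmodType R^o) :
  affine V1 -> affine V2 ->
  affine (outcome V1 V2 : convex_lmodType E -> convex_lmodType (R^o * R^o)%type).
Proof. by move=> a1 a2 t x y; rewrite /outcome a1 a2. Qed.

(** In the outcome plane, a supported point [b] lies on or above the chord from
    [a] to [c]: the inequality is that of the chord, cleared of its denominator
    [V1 c - V1 a]. The point [b] maximizes some [mu delta], and [delta] is not
    zero because [V1 c] exceeds [V1 b]; averaging the maximality inequalities
    at [a] and [c] with the weights of the chord cancels the [V1] terms. *)
Lemma supported_concave {R : realType} {T : Type} (V1 V2 : T -> R) (X : set T)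
    (a b c : T) :
  pareto_supported V1 V2 X b -> X a -> X c -> V1 a < V1 b -> V1 b < V1 c ->
  (V1 c - V1 b) * V2 a + (V1 b - V1 a) * V2 c <= (V1 c - V1 a) * V2 b.
Proof.
move=> [_ _ [[d| |]//= d0 [_ bmax]]] Xa Xc ab bc;
  have := bmax a Xa; have := bmax c Xc; rewrite /mu => cb ab'.
  have d_gt0 : 0 < d.
    rewrite lt_neqAle -lee_fin d0 andbT; apply: contraL bc => /eqP d0'.
    by rewrite -leNgt; move: cb; rewrite -d0' !mul0r !addr0.
  rewrite -(ler_pM2l d_gt0); nra.
(* Here delta is +oo, so V2 b bounds both V2 a and V2 c. *)
nra.
Qed.

(** Among the points of the hull of the outcomes where [mu d] is maximal, the one
    with the largest [V1] is extreme, hence an actual outcome. It is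
    Pareto-optimal because [0 < d] makes [mu d] strictly increasing for
    domination. *)
Lemma exists_supported_mu_max {R : realType} {E : lmodType R}
    (V1 V2 : convex_lmodType E -> convex_lmodType R^o)
    (X : set (convex_lmodType E)) (d : R) :
  affine V1 -> affine V2 -> X !=set0 -> polytope (convex_hull X) -> 0 < d ->
  exists2 z, pareto_supported V1 V2 X z & maximizes (mu V1 V2 d%:E) X z.
Proof.
move=> a1 a2 [x0 Xx0] polX d0.
have d_neq0 := lt0r_neq0 d0.
pose out : convex_lmodType E -> convex_lmodType (R^o * R^o)%type := outcome V1 V2.
pose u (p : convex_lmodType (R^o * R^o)%type) : convex_lmodType R^o :=
  (p.1 : R) + d * (p.2 : R).
pose w (p : convex_lmodType (R^o * R^o)%type) : convex_lmodType R^o := p.1.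
have au : affine u.
  by move=> t x y; rewrite /u !conv_lmodE /= /GRing.scale /=; ring.
have aw : affine w by [].
have aout : affine out by exact: outcome_affine.
have [|p Pp pmax] := polytope_lex_max au aw (polytope_hull_image aout polX).
  by exists (out x0); apply: sub_gen_smallest; exists x0.
have pext : extreme_point (convex_hull (out @` X)) p.
  apply: lex_max_extreme pmax => //.
  move=> [x1 x2] [y1 y2]; rewrite /u /w /= => + e1; rewrite e1.
  by move=> /addrI/(mulfI d_neq0) ->.
have [z Xz zp] := extreme_point_hull_mem pext.
have zmax : maximizes (mu V1 V2 d%:E) X z.
  split=> // y Xy; have : lex_le u w (out y) p.
    by apply: pmax; apply: sub_gen_smallest; exists y.
  by rewrite -zp /lex_le /u /out /= /mu => -[/ltW//|[-> _]].
exists z => //; split; last by exists d%:E => //; rewrite lee_fin ltW.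
  split=> // -[y Xy [le1 [le2 lt12]]].
  have := zmax.2 y Xy; rewrite /mu; nra.
by rewrite -[outcome _ _ z]/(out z) zp.
Qed.

(** The edge of the outcome hull between consecutive supported points. A
    maximizer [s] of [mu d] taken in [S] has [V1 s] outside the open interval
    from [V1 x1] to [V1 x2]; were it strictly above the line through the two
    outcomes, it would push [x1] (if to the left) or [x2] (if to the right)
    below a chord, or dominate [x1] or [x2] if it shares its [V1]. *)
Lemma consecutive_mu_max {R : realType} {E : lmodType R}
    (V1 V2 : convex_lmodType E -> convex_lmodType R^o)
    (X S : set (convex_lmodType E)) (x1 x2 : E) (d : R) :
  affine V1 -> affine V2 -> X !=set0 -> polytope (convex_hull X) -> 0 <= d ->
  supported_representatives V1 V2 X S -> consecutive V1 S x1 x2 ->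
  mu V1 V2 d%:E x1 = mu V1 V2 d%:E x2 ->
  maximizes (mu V1 V2 d%:E) X x1.
Proof.
move=> a1 a2 X0 polX d0 [Ssup Srepr] [Sx1 Sx2 lt12 ncons] mu12.
have supx1 := Ssup _ Sx1; have supx2 := Ssup _ Sx2.
have [par1 _ _] := supx1; have [par2 _ _] := supx2.
have [Xx1 _] := par1; have [Xx2 _] := par2.
(* With d = 0, equal values of mu would mean equal values of V1. *)
have d_gt0 : 0 < d.
  rewrite lt_neqAle d0 andbT; apply: contraL lt12 => /eqP d0'.
  by move: mu12; rewrite /mu -d0' !mul0r !addr0 => ->; rewrite ltxx.
have [z supz zmax] := exists_supported_mu_max a1 a2 X0 polX d_gt0.
have [s [[Ss [s1 s2]] _]] := Srepr z supz.
have [[Xs _] _ _] := Ssup _ Ss.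
have smax : maximizes (mu V1 V2 d%:E) X s.
  by split=> // y /zmax.2; rewrite /mu s1 s2.
suff mus : mu V1 V2 d%:E s <= mu V1 V2 d%:E x1.
  by split=> // y /smax.2 /le_trans; apply.
have not_dom x : pareto_optimal V1 V2 X x ->
    (V1 s : R) = V1 x -> (V2 s : R) <= V2 x.
  move=> [_ parx] e1; rewrite leNgt; apply/negP => lt2; apply: parx.
  by exists s => //; split; [rewrite e1|split; [exact: ltW|right]].
have [s_x1|x1_s|s_x1] := ltgtP (V1 s : R) (V1 x1).
- have := supported_concave supx1 Xs Xx2 s_x1 lt12.
  move: mu12; rewrite /mu; nra.
- have [s_x2|x2_s|s_x2] := ltgtP (V1 s : R) (V1 x2).
  + by case: ncons; exists s => //; apply/andP.
  + have := supported_concave supx2 Xx1 Xs lt12 x2_s.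
    move: mu12; rewrite /mu; nra.
  + have := not_dom x2 par2 s_x2; move: mu12; rewrite /mu; nra.
- have := not_dom x1 par1 s_x1; rewrite /mu s_x1; nra.
Qed.

(** * The upper bound *)

Lemma dotp_affine {R : realType} {n : nat} (a : 'rV[R]_n) :
  @affine R 'cV[R]_n R^o (dotp a).
Proof.
by move=> t x y; rewrite !conv_lmodE /dotp mulmxDr -!scalemxAr !mxE.
Qed.

Theorem mainTheorem3 (R : realType) (n K : nat)
    (X : set 'cV[R]_n) (c gamma : 'rV[R]_n) (alpha beta : R)
    (tgamma : 'I_K -> 'rV[R]_n) (talpha tbeta : 'I_K -> R)
    (X_nonempty : X !=set0)
    (hull_polytope : polytope (convex_hull X))
    (exists_SP : exists2 xSP, maximizes (dotp c) X xSP & dotp gamma xSP <= beta)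
    (S : set 'cV[R]_n)
    (S_repr : supported_representatives (dotp c) (dotp gamma) X S)
    (x1 x2 : 'cV[R]_n) (x1x2 : consecutive (dotp c) S x1 x2)
    (delta : R) (delta_ge0 : 0 <= delta)
    (mu_eq : mu (dotp c) (dotp gamma) delta%:E x1
             = mu (dotp c) (dotp gamma) delta%:E x2) :
  forall xstar : 'cV[R]_n,
    maximizes (dotp c) (feasible X gamma alpha beta tgamma talpha tbeta) xstar ->
    dotp c xstar <= V1bar (dotp c) (dotp gamma) beta x1 delta.
Proof.
move=> xstar [[Xxs /andP[beta_le _] _] _].
have [_ mumax] := consecutive_mu_max (dotp_affine c) (dotp_affine gamma)
  X_nonempty hull_polytope delta_ge0 S_repr x1x2 mu_eq.
have := mumax xstar Xxs.
rewrite /V1bar lerBrDr; apply: le_trans.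
by rewrite /mu lerD2l ler_wpM2l.
Qed.
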